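(* Let $\mathfrak{o}$ be a compact discrete valuation ring of characteristic $0$ with residue field of odd characteristic. Then the Lie lattice $\mathfrak{sl}_4(\mathfrak{o})$ is not shadow-preserving; that is, there exist $r\in\mathbb{N}$ and $a\in\mathfrak{sl}_4(\mathfrak{o}/\mathfrak{p}^r)$ such that $a$ has no shadow-preserving lift to $\mathfrak{sl}_4(\mathfrak{o}/\mathfrak{p}^{r+1})$.
   Context: $\mathfrak{p}$ is the maximal ideal of $\mathfrak{o}$, $\mathbb{F}_q$ its residue field, $\mathfrak{o}_r=\mathfrak{o}/\mathfrak{p}^r$ for $r\in\mathbb{N}=\{1,2,\dots\}$. For $a\in\mathfrak{sl}_4(\mathfrak{o}_r)$, the (group) shadow $\mathrm{Sh}_{\mathrm{SL}_4(\mathfrak{o}_r)}(a)\le\mathrm{SL}_4(\mathbb{F}_q)$ is the reduction mod $\mathfrak{p}$ of the stabilizer of $a$ under the adjoint (conjugation) action of $\mathrm{SL}_4(\mathfrak{o}_r)$ on $\mathfrak{sl}_4(\mathfrak{o}_r)$. An element $b\in\mathfrak{sl}_4(\mathfrak{o}_{r+1})$ is a shadow-preserving lift of $a\in\mathfrak{sl}_4(\mathfrak{o}_r)$ if $b\equiv a$ mod $\mathfrak{p}^r$ and $\mathrm{Sh}_{\mathrm{SL}_4(\mathfrak{o}_{r+1})}(b)=\mathrm{Sh}_{\mathrm{SL}_4(\mathfrak{o}_r)}(a)$. The lattice $\mathfrak{sl}_4(\mathfrak{o})$ is shadow-preserving if for all $t\in\mathbb{N}$ every element of $\mathfrak{sl}_4(\mathfrak{o}_t)$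 has a shadow-preserving lift to $\mathfrak{sl}_4(\mathfrak{o}_{t+1})$. *)

(* Defs.v *)
From HB Require Import structures.
From mathcomp Require Import all_boot all_order all_algebra.
From mathcomp Require Import generic_quotient ring_quotient.
From mathcomp Require Import mathcomp_extra boolp classical_sets filter topology.

Set Implicit Arguments.
Unset Strict Implicit.
Unset Printing Implicit Defensive.

Import GRing.Theory.
Local Open Scope classical_set_scope.
Local Open Scope ring_scope.
Local Open Scope quotient_scope.

Definition is_ideal (R : comNzRingType) (I : set R) : Prop :=
  I 0 /\ forall c x y, I x -> I y -> I (c * x + y).

(* A discrete valuation ring is a principal ideal domain that is local
   (the non-units are closed under addition) and is not a field. *)
HB.mixin Record isDVR R & GRing.IntegralDomain R := {
  dvr_principal : forall I : set R, is_ideal I ->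
    exists a, I = [set x | exists c, x = c * a];
  dvr_local : forall x y : R, x \isn't a GRing.unit ->
    y \isn't a GRing.unit -> x + y \isn't a GRing.unit;
  dvr_not_field : exists2 x : R, x != 0 & x \isn't a GRing.unit
}.

#[short(type="dvrType")]
HB.structure Definition DVR := {R of GRing.IntegralDomain R & isDVR R}.

Definition mul_ideal (R : comNzRingType) (I J : set R) : set R :=
  [set x | exists2 s : seq (R * R),
     (forall u, u \in s -> I u.1 /\ J u.2) & x = \sum_(u <- s) u.1 * u.2].

Definition max_ideal (R : dvrType) : set R := [set x | x \isn't a GRing.unit].
Arguments max_ideal R _ : clear implicits.

Definition max_pow (R : dvrType) (r : nat) : set R :=
  iter r (mul_ideal (max_ideal R)) setT.
Arguments max_pow R r _ : clear implicits.

Section MaxPow.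
Variable R : dvrType.
Implicit Types (x y c : R) (r s : nat).

Lemma mul_ideal_is_ideal (I J : set R) :
  is_ideal J -> is_ideal (mul_ideal I J).
Proof.
move=> [J0 JD]; split=> [|c x y [s sIJ ->] [t tIJ ->]].
  by exists [::] => //; rewrite big_nil.
exists ([seq (u.1, c * u.2) | u <- s] ++ t).
  move=> u; rewrite mem_cat => /orP[/mapP[v vs ->]|/tIJ //].
  have [Iv Jv] := sIJ _ vs; split=> //=.
  by rewrite -[_ * _]addr0; apply: JD.
rewrite big_cat big_map /= mulr_sumr; congr (_ + _).
by apply: eq_bigr => u _; rewrite mulrCA.
Qed.

Lemma max_pow_ideal r : is_ideal (max_pow R r).
Proof. by elim: r => [|r IHr]; [split | apply: mul_ideal_is_ideal]. Qed.

Lemma max_powS r : max_pow R r.+1 `<=` max_pow R r.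
Proof.
move=> x [s sP ->]; have [P0 PD] := max_pow_ideal r.
rewrite big_seq; apply: big_ind => // [y z yP zP|u us].
  by rewrite -[y]mul1r; apply: PD.
by rewrite -[_ * _]addr0; apply: PD => //; case: (sP _ us).
Qed.

Lemma max_pow_le r s : (s <= r)%N -> max_pow R r `<=` max_pow R s.
Proof.
move=> /subnK <-; elim: (r - s)%N => [|d IHd] //.
by rewrite addSn => x /max_powS /IHd.
Qed.

Lemma max_pow_nonunit r x : max_pow R r.+1 x -> x \isn't a GRing.unit.
Proof.
move=> [s sP ->]; rewrite big_seq; apply: (big_ind (max_ideal R)).
- by rewrite /max_ideal /= unitr0.
- exact: dvr_local.
- by move=> u /sP[u1 _]; rewrite /max_ideal /= unitrM negb_and u1.
Qed.

Lemma max_pow_idealr_closed r :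
  idealr_closed (fun x => x \in max_pow R r.+1).
Proof.
have [P0 PD] := max_pow_ideal r.+1; split.
- by apply/mem_set.
- by apply/negP => /set_mem /max_pow_nonunit; rewrite unitr1.
- by move=> c x y /set_mem xP /set_mem yP; apply/mem_set/PD.
Qed.

End MaxPow.

Definition max_pow_pred (R : dvrType) (r : nat) : {pred R} :=
  fun x => x \in max_pow R r.+1.

HB.instance Definition _ (R : dvrType) (r : nat) :=
  isIdealr.Build R (@max_pow_pred R r) (@max_pow_idealr_closed R r).

(* [resring R r] is R / p^r for r > 0.  Quotient rings being formed only for
   proper ideals, [resring R 0] is by convention R / p. *)
Definition resring (R : dvrType) (r : nat) : Type :=
  {ideal_quot (@max_pow_pred R r.-1)}.

HB.instance Definition _ (R : dvrType) (r : nat) :=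
  GRing.ComNzRing.on (resring R r).
HB.instance Definition _ (R : dvrType) (r : nat) :=
  EqQuotient.on (resring R r).

(* As R is local, the units of R / p^r are the classes of the units of R. *)
Section Units.
Variables (R : dvrType) (r : nat).
Local Notation Q := (resring R r).

Definition resunit : pred Q := fun x => repr x \is a GRing.unit.
Definition resinv (x : Q) : Q := \pi_Q (repr x)^-1.

Let piM (x y : R) : \pi_Q (x * y) = \pi_Q x * \pi_Q y.
Proof. exact: (rmorphM \pi_{ideal_quot (@max_pow_pred R r.-1)}). Qed.

Let pi1 : \pi_Q 1 = 1.
Proof. exact: (rmorph1 \pi_{ideal_quot (@max_pow_pred R r.-1)}). Qed.

Lemma resring_eqP (x y : R) :
  reflect (max_pow R r.-1.+1 (x - y)) (\pi_Q x == \pi_Q y).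
Proof.
rewrite -(Quotient.idealrBE (@max_pow_pred R r.-1)).
by apply: (iffP idP) => [/set_mem|/mem_set].
Qed.

Lemma resmulV : {in resunit, left_inverse 1 resinv *%R}.
Proof. by move=> x ux; rewrite -{2}[x]reprK /resinv -piM mulVr. Qed.

Lemma resunitP (x y : Q) : y * x = 1 -> resunit x.
Proof.
rewrite -[x in y * x]reprK -[y]reprK -piM -pi1 => /eqP/resring_eqP.
move/max_pow_nonunit => nu; apply: contraT => nx.
suff : (1 : R) \isn't a GRing.unit by rewrite unitr1.
rewrite -(subKr (repr y * repr x) 1); apply: dvr_local.
  by rewrite unitrM negb_and nx orbT.
by rewrite unitrN.
Qed.

Lemma resinv_out : {in [predC resunit], resinv =1 id}.
Proof. by move=> x nx; rewrite /resinv invr_out ?reprK. Qed.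

End Units.

HB.instance Definition _ (R : dvrType) (r : nat) :=
  GRing.ComNzRing_hasMulInverse.Build (resring R r)
    (@resmulV R r) (@resunitP R r) (@resinv_out R r).

(* The reduction map R / p^r -> R / p^s, for 0 < s <= r. *)
Definition red (R : dvrType) (r s : nat) (x : resring R r) : resring R s :=
  \pi_(resring R s) (repr x).

Lemma red_pi (R : dvrType) (r s : nat) (x : R) : (s <= r)%N ->
  red s (\pi_(resring R r) x) = \pi_(resring R s) x.
Proof.
move=> le_sr; apply/eqP/resring_eqP/(@max_pow_le _ r.-1.+1).
  by rewrite ltnS -!subn1 leq_sub2r.
by apply/resring_eqP; rewrite reprK.
Qed.

(* The ring R with its p-adic topology. *)
Definition adic (R : dvrType) : Type := R.

HB.instance Definition _ (R : dvrType) := GRing.IntegralDomain.on (adic R).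

Definition adic_nbhs (R : dvrType) (x : adic R) : set_system (adic R) :=
  filter_from [set: nat] (fun r => [set y : adic R | max_pow R r (y - x)]).

HB.instance Definition _ (R : dvrType) := hasNbhs.Build (adic R) (@adic_nbhs R).

Section AdicTopology.
Variable R : dvrType.

Lemma adic_nbhs_filter (x : adic R) : ProperFilter (nbhs x).
Proof.
apply: filter_from_proper => [|r _].
  apply: filter_from_filter => [|r s _ _]; first by exists 0%N.
  exists (maxn r s) => // y /= yP; split; apply: max_pow_le yP.
    exact: leq_maxl.
  exact: leq_maxr.
by exists x; rewrite /= subrr; case: (max_pow_ideal R r).
Qed.

Lemma adic_nbhs_singleton (x : adic R) (A : set (adic R)) : nbhs x A -> A x.
Proof.
by move=> [r _]; apply; rewrite /= subrr; case: (max_pow_ideal R r).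
Qed.

Lemma adic_nbhs_nbhs (x : adic R) (A : set (adic R)) :
  nbhs x A -> nbhs x (nbhs^~ A).
Proof.
move=> [r _ rA]; exists r => // y /= yx; exists r => // z /= zy; apply: rA.
rewrite /= -(subrK y z) -addrA -[z - y]mul1r.
by case: (max_pow_ideal R r) => _; apply.
Qed.

HB.instance Definition _ := Nbhs_isNbhsTopological.Build (adic R)
  adic_nbhs_filter adic_nbhs_singleton adic_nbhs_nbhs.
End AdicTopology.

Definition special_linear (A : comUnitRingType) (n : nat) : set 'M[A]_n :=
  [set g | \det g = 1].

Definition sl_lie (A : comUnitRingType) (n : nat) : set 'M[A]_n :=
  [set a | \tr a = 0].

Definition SL_stabilizer (A : comUnitRingType) (n : nat) (a : 'M[A]_n) :
  set 'M[A]_n :=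
  [set g | special_linear g /\ g *m a *m invmx g = a].

Definition shadow (R : dvrType) (n r : nat) (a : 'M[resring R r]_n) :
  set 'M[resring R 1]_n :=
  map_mx (red 1) @` SL_stabilizer a.

Definition shadow_preserving_lift (R : dvrType) (n r : nat)
    (a : 'M[resring R r]_n) (b : 'M[resring R r.+1]_n) : Prop :=
  [/\ sl_lie b, map_mx (red r) b = a & shadow b = shadow a].

Definition sl_shadow_preserving (R : dvrType) (n : nat) : Prop :=
  forall (r : nat) (a : 'M[resring R r]_n), (0 < r)%N -> sl_lie a ->
  exists b : 'M[resring R r.+1]_n, shadow_preserving_lift a b.

(* Main.v *)
(* Let w be a uniformizer. Modulo p^2 take, in 2 x 2 blocks, the matrix
   a = [[0, 1], [w, w B]] with B = [[0, 1], [0, 0]]. For every Q, a commutes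
   with [[1, Q], [w Q, 1 + w Q B]]; for Q = [[1, 0], [1, 0]] this matrix has
   determinant 1, so [[1, Q], [0, 1]] lies in the shadow of a. If b lifts a
   modulo p^3 and g reduces to [[1, Q], [0, 1]] modulo p, then comparing the
   off-diagonal blocks of g b = b g, the lower one modulo p^3 and the upper
   one modulo p^2, forces w^2 (Q B - B Q) to have lower right entry zero
   modulo p^3, whereas that entry is w^2. *)
Require Import Defs.
From HB Require Import structures.
From mathcomp Require Import all_boot all_order all_algebra.
From mathcomp Require Import ring generic_quotient ring_quotient.
From mathcomp Require Import boolp classical_sets filter topology.

Local Open Scope classical_set_scope.
Local Open Scope ring_scope.

Import GRing.Theory.
Local Open Scope quotient_scope.

Set Implicit Arguments.
Unset Strict Implicit.
Unset Printing Implicit Defensive.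

Section Matrices.
Variable A : comNzRingType.
Implicit Types (t : A) (b c g h : 'M[A]_4).

Definition unip_mx : 'M[A]_2 := delta_mx 0 1.

(** The blocks Q here and B in [unip_mx] are chosen so that Q B - Q has trace and determinant zero,
    which keeps [stab_mx] in SL_4, while Q B - B Q has lower right entry 1, which is the obstruction
    to lifting. *)
Definition idem_mx : 'M[A]_2 := delta_mx 0 0 + delta_mx 1 0.

Definition bad_mx t : 'M[A]_4 :=
  block_mx (0 : 'M_2) 1%:M t%:M (t *: unip_mx).

(** The upper blocks 1 and Q force the lower ones: if g commutes with [bad_mx t], the lower row of
    blocks of g is its upper row times [bad_mx t]. *)
Definition stab_mx t : 'M[A]_4 :=
  block_mx (1%:M : 'M_2) idem_mx (t *: idem_mx)
    (1%:M + t *: (idem_mx *m unip_mx)).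

Lemma tr_bad_mx t : \tr (bad_mx t) = 0.
Proof.
by rewrite (mxtrace_block (0 : 'M_2)) !raddf0 add0r mxtraceZ /mxtrace
  !big_ord_recl big_ord0 !mxE /= !addr0 mulr0.
Qed.

Lemma idem_mxK : idem_mx *m idem_mx = idem_mx.
Proof.
by rewrite mulmxDl !mulmxDr !mul_delta_mx_cond /= !mulr0n !mulr1n !addr0.
Qed.

(** Since Q is idempotent, the Schur complement of the upper left block is 1 + t (Q B - Q), of
    determinant 1 for every t. *)
Lemma det_stab_mx t : \det (stab_mx t) = 1.
Proof.
have -> : stab_mx t = block_mx (1%:M : 'M_2) 0 (t *: idem_mx) 1%:M *m
    block_mx 1%:M idem_mx 0
      (1%:M + t *: (idem_mx *m unip_mx) - t *: idem_mx).
  rewrite mulmx_block !mul1mx !mul0mx !mulmx1 !addr0.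
  by rewrite -scalemxAl idem_mxK addrC addrNK.
rewrite det_mulmx (det_lblock (1%:M : 'M_2)) (det_ublock (1%:M : 'M_2)).
rewrite !det1 !mul1r.
rewrite (expand_det_row _ ord0) !big_ord_recl big_ord0 /cofactor.
rewrite !det_mx11 !mxE /=.
rewrite !big_ord_recl !big_ord0 !mxE /=.
ring.
Qed.

Lemma stab_mx_comm t : t * t = 0 ->
  stab_mx t *m bad_mx t = bad_mx t *m stab_mx t.
Proof.
move=> t2; rewrite /stab_mx /bad_mx !(@mulmx_block A 2 2 2 2 2 2).
apply: (f_equal4 (@block_mx A 2 2 2 2)).
- by rewrite mul0mx !mulmx0 !add0r mul1mx mul_mx_scalar.
- by rewrite mul0mx !mulmx1 !mul1mx add0r -scalemxAr.
- rewrite mulmx0 mulmx1 add0r mul_mx_scalar scalerDr scalerA t2 scale0r addr0.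
  by rewrite -scalemxAl -scalemxAr scalerA t2 scale0r addr0 scalemx1.
- rewrite mulmx1 mul_scalar_mx mulmxDl mulmxDr mul1mx mulmx1.
  rewrite -!scalemxAl -!scalemxAr !scalerA t2 !scale0r.
  by rewrite !addr0.
Qed.

(* In 2 x 2 blocks, [(g b - b g)_dl + t (g b - b g)_ur] has lower right entry
   [t ^+ 2] modulo [t ^+ 3], whatever [c] and [h] are. *)
Lemma no_comm_lift t b c g h : t ^+ 3 = 0 ->
  b = bad_mx t + t ^+ 2 *: c -> g = stab_mx t + t *: h ->
  g *m b = b *m g -> t ^+ 2 = 0.
Proof.
have mod_t3 x y z u : x - y + t * (z - u) = t ^+ 2 -> x = y -> z = u ->
    t ^+ 2 = 0 by move=> <- -> ->; rewrite !subrr mulr0 addr0.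
move=> t3 -> ->; rewrite -[c](@submxK _ 2 2 2 2) -[h](@submxK _ 2 2 2 2).
rewrite /bad_mx /stab_mx !(@scale_block_mx _ 2 2 2 2).
rewrite !(@add_block_mx _ 2 2 2 2) !(@mulmx_block _ 2 2 2 2 2 2).
move/(@eq_block_mx _ 2 2 2 2).
(* In the combination the diagonal blocks of h cancel and c occurs only with [t ^+ 3]. Modulo
   [t ^+ 3] only - t^2 B h_dl is left of h, and its lower row vanishes with that of B. *)
move=> [_ /matrixP/(_ 1 1) ur /matrixP/(_ 1 1) dl _]; apply: mod_t3 dl ur.
rewrite !mxE !big_ord_recl !big_ord0 !mxE /=.
rewrite !big_ord_recl !big_ord0 !mxE /=.
have -> : lift ord0 ord0 = 1 :> 'I_2 by apply: val_inj.
ring: t3.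
Qed.
End Matrices.

Lemma map_bad_mx (A B : comNzRingType) (f : {rmorphism A -> B}) (t : A) :
  map_mx f (bad_mx t) = bad_mx (f t).
Proof.
by rewrite (map_block_mx f (0 : 'M_2)) raddf0 map_mx1 map_scalar_mx map_mxZ
  map_delta_mx.
Qed.

Lemma map_stab_mx (A B : comNzRingType) (f : {rmorphism A -> B}) (t : A) :
  map_mx f (stab_mx t) = stab_mx (f t).
Proof.
rewrite (map_block_mx f (1%:M : 'M_2)) !map_mxD !map_mxZ map_mxM map_mx1.
by rewrite map_mxD !map_delta_mx.
Qed.

Definition resproj (R : dvrType) (r : nat) : {rmorphism R -> resring R r} :=
  \pi_{ideal_quot (@max_pow_pred R r.-1)}.

Section Uniformizer.
Variables (R : dvrType) (w : R).
Hypothesis max_idealE : max_ideal R = [set x | exists c, x = c * w].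

Lemma max_powE r : max_pow R r = [set x | exists c, x = c * w ^+ r].
Proof.
elim: r => [|r IHr].
  by apply/seteqP; split=> // x _; exists x; rewrite expr0 mulr1.
rewrite /max_pow iterS -/(max_pow R r) IHr max_idealE.
apply/seteqP; split=> [x [s sP ->]|_ [c ->]]; last first.
  exists [:: (c * w, w ^+ r)]; last by rewrite big_seq1 /= exprS mulrA.
  move=> _ /[1!inE] /eqP -> /=; split; first by exists c.
  by exists 1; rewrite mul1r.
rewrite big_seq; apply: (big_ind (fun y => exists c, y = c * w ^+ r.+1)).
- by exists 0; rewrite mul0r.
- by move=> _ _ [c ->] [d ->]; exists (c + d); rewrite mulrDl.
- move=> u /sP[[c ->] [d ->]]; exists (c * d).
  by rewrite exprS; ring.
Qed.

Lemma resproj_eq r x y : (0 < r)%N ->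
  resproj R r x = resproj R r y <-> exists c, x = y + c * w ^+ r.
Proof.
move=> r_gt0; have -> : resproj R r x = resproj R r y <->
    max_pow R r (x - y).
  (* [resring R r] is the quotient by [max_pow R r.-1.+1], which is the r-th power only for positive
     r. *)
  by case: r r_gt0 => // r _; split=> [/eqP/resring_eqP|xy] //;
    apply/eqP/resring_eqP.
rewrite max_powE; split=> [[c cE]|[c ->]]; exists c.
  by rewrite -cE addrC subrK.
by rewrite addrC addKr.
Qed.

Lemma red_resproj r s x : (s <= r)%N ->
  red s (resproj R r x) = resproj R s x.
Proof. exact: red_pi. Qed.

(** As [red] is defined through representatives, reductions are computed on matrices over R, where
    [resproj] is a ring morphism. *)
Lemma map_red_resproj n r s (M : 'M[R]_n) : (s <= r)%N ->
  map_mx (red s) (map_mx (resproj R r) M) = map_mx (resproj R s) M.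
Proof. by move=> sr; apply/matrixP=> i j; rewrite !mxE red_resproj. Qed.

(** This supplies the unknown matrices c and h of [no_comm_lift]. *)
Lemma red_eq_lift n r s (M N : 'M[resring R r]_n) : (0 < s <= r)%N ->
  map_mx (red s) M = map_mx (red s) N ->
  exists C, M = N + resproj R r w ^+ s *: C.
Proof.
move=> /andP[s_gt0 sr] /matrixP MN.
have entryP i j : {c | M i j = N i j + resproj R r w ^+ s * c}.
  apply: cid; move: (MN i j); rewrite !mxE.
  rewrite -[M i j]reprK -[N i j]reprK.
  move: (repr _) (repr _) => x y; rewrite -!/(resproj R r _) !red_resproj //.
  move/(resproj_eq _ _ s_gt0) => [c ->]; exists (resproj R r c).
  by rewrite rmorphD rmorphM rmorphXn mulrC.
exists (\matrix_(i, j) sval (entryP i j)).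
by apply/matrixP=> i j; rewrite !mxE; case: (entryP i j).
Qed.

(** Otherwise w^r = c w^(r+1). As R is not a field, w is nonzero, and cancelling w^r would make w a
    unit. *)
Lemma resproj_unif_neq0 r : resproj R r.+1 w ^+ r != 0.
Proof.
have w_nonunit : w \isn't a GRing.unit.
  by have : max_ideal R w; [rewrite max_idealE; exists 1; rewrite mul1r|].
have w_neq0 : w != 0.
  have [x x_neq0 x_nonunit] := dvr_not_field (s := R).
  have : max_ideal R x by [].
  rewrite max_idealE => -[c xE].
  by apply: contraNneq x_neq0 => w0; rewrite xE w0 mulr0.
apply/eqP; rewrite -rmorphXn -(rmorph0 (resproj R r.+1)) resproj_eq // => -[c].
rewrite add0r exprS mulrA -{1}[w ^+ r]mul1r => /mulIf.
move=> /(_ (expf_neq0 _ w_neq0)) cw1; move/negP: w_nonunit; apply.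
by apply/unitrPr; exists c; rewrite mulrC -cw1.
Qed.

Lemma resproj_unif_expr r : (0 < r)%N -> resproj R r w ^+ r = 0.
Proof.
move=> r_gt0; rewrite -rmorphXn -(rmorph0 (resproj R r)) resproj_eq //.
by exists 1; rewrite add0r mul1r.
Qed.
End Uniformizer.

Lemma exists_uniformizer (R : dvrType) :
  exists w : R, max_ideal R = [set x | exists c, x = c * w].
Proof.
apply: dvr_principal; split; first by rewrite /max_ideal /= unitr0.
move=> c x y x_nonunit y_nonunit; apply: dvr_local => //.
by rewrite unitrM negb_and x_nonunit orbT.
Qed.

Lemma bad_mx_no_lift (R : dvrType) (w : R) (b : 'M[resring R 3]_4) :
  max_ideal R = [set x | exists c, x = c * w] ->
  ~ shadow_preserving_lift (bad_mx (resproj R 2 w)) b.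
Proof.
move=> wE [_ b_lift b_shadow].
have : shadow (bad_mx (resproj R 2 w))
    (map_mx (red 1) (stab_mx (resproj R 2 w))).
  exists (stab_mx (resproj R 2 w)) => //; split; first exact: det_stab_mx.
  rewrite stab_mx_comm; last by rewrite -expr2 (resproj_unif_expr wE).
  by rewrite mulmxK // unitmxE det_stab_mx unitr1.
rewrite -b_shadow -map_stab_mx map_red_resproj // => -[g [/= detg gb]].
have g_unit : g \in unitmx by rewrite unitmxE detg unitr1.
have {gb} gb : g *m b = b *m g by rewrite -{2}gb mulmxKV.
(* The matrices [stab_mx w] and [bad_mx w] over R also project to R / p^3. There g is compared with
   the first modulo p and b with the second modulo p^2. *)
rewrite -(@map_red_resproj R 4 3 1) //.
move=> /(red_eq_lift wE (isT : 0 < 1 <= 3)%N).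
move: b_lift; rewrite -map_bad_mx -(@map_red_resproj R 4 3 2) //.
move=> /(red_eq_lift wE (isT : 0 < 2 <= 3)%N).
rewrite map_bad_mx map_stab_mx => -[c bE] [h gE].
have := no_comm_lift (resproj_unif_expr wE (isT : 0 < 3)%N) bE gE gb.
exact/eqP/(resproj_unif_neq0 wE 2).
Qed.

Theorem theorem4 (R : dvrType)
    (R_compact : compact [set: adic R])
    (R_char0 : [pchar R] =i pred0)
    (res_odd_char : exists2 p : nat, odd p & p \in [pchar (resring R 1)]) :
  ~ sl_shadow_preserving R 4 /\
  exists (r : nat) (a : 'M[resring R r]_4),
    [/\ (0 < r)%N, sl_lie a &
        ~ exists b : 'M[resring R r.+1]_4, shadow_preserving_lift a b].
Proof.
have [w wE] := exists_uniformizer R.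
have no_lift : ~ exists b : 'M[resring R 3]_4,
    shadow_preserving_lift (bad_mx (resproj R 2 w)) b.
  by case=> b /(bad_mx_no_lift wE).
have sl_a : sl_lie (bad_mx (resproj R 2 w)) by exact: tr_bad_mx.
split; first by move/(_ 2 _ isT sl_a).
by exists 2%N, (bad_mx (resproj R 2 w)).
Qed.
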